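(* Let $N\ge2$, let $\{\mathbf{T}_n\}_{0\le n<N}$ be the minimal Hermite-type basis of $\mathbb{R}^N$ and denote $\mathbf{T}_N:=\mathbf{T}_{N-1}$. There are real coefficients $a_n$ and nonzero real coefficients $b_n$ such that for all $0\le n<N-5$ $$\mathbf{T}_{n+4}=\big(\mathscr{L}\mathbf{T}_n-a_n\mathbf{T}_n-b_{n-4}\mathbf{T}_{n-4}\big)/b_n,$$ where the coefficients satisfy $$a_n=\langle\mathscr{L}\mathbf{T}_n,\mathbf{T}_n\rangle\quad\text{and}\quad b_n^2=\|\mathscr{L}\mathbf{T}_n-a_n\mathbf{T}_n-b_{n-4}\mathbf{T}_{n-4}\|^2=\|\mathscr{L}\mathbf{T}_n\|^2-a_n^2-b_{n-4}^2 .$$ In these formulas $b_n=0$ and $\mathbf{T}_n=\mathbf{0}$ for $n<0$. When $N$ is odd (respectively, even) the recurrence $\mathbf{T}_{n+4}=\big(\mathscr{L}\mathbf{T}_n-a_n\mathbf{T}_n-b_{n-4}\mathbf{T}_{n-4}\big)/b_n$ holds also for $n=N-5$ (respectively, $n=N-4$), provided this index is nonnegative.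
   Context: Let $I_N=\{k\in\mathbb{Z}: -\lceil N/2\rceil+1\le k\le\lfloor N/2\rfloor\}$. Entries of a vector $\mathbf{a}\in\mathbb{C}^N$ (or $\mathbb{R}^N$) are labelled by $I_N$, and $\mathbf{a}$ is identified with the $N$-periodic function on $\mathbb{Z}$ that agrees with it on $I_N$. The dot product is $\langle\mathbf{a},\mathbf{b}\rangle=\sum_{k\in I_N}\mathbf{a}(k)\mathbf{b}(k)$ and $\|\mathbf{a}\|=\sqrt{\langle\mathbf{a},\bar{\mathbf{a}}\rangle}$. Put $\omega=2\pi/N$. The (centered) discrete Fourier transform is the linear map $\mathscr{F}$ on $\mathbb{C}^N$ given by $(\mathscr{F}\mathbf{a})(l)=\frac{1}{\sqrt{N}}\sum_{k\in I_N}e^{-\mathrm{i}\omega kl}\mathbf{a}(k)$, $l\in I_N$. The operator $\mathscr{L}$ acts on vectors in $\mathbb{R}^N$, viewed as $N$-periodic functions on $\mathbb{Z}$, by $(\mathscr{L}\mathbf{a})(k)=\mathbf{a}(k+1)+\mathbf{a}(k-1)+2\cos(\omega k)\mathbf{a}(k)$. For a nonzero vector $\mathbf{a}$, $\operatorname{width}(\mathbf{a})$ is the integer $n\in\{0,1,\dots,\lfloor N/2\rfloor\}$ such that $\mathbf{a}(n)\ne 0$ or $\mathbf{a}(-n)\neq 0$, but $\mathbf{a}(k)=0$ whenever $n<|k|\le\lfloor N/2\rfloor$. The minimal Hermite-type basis of $\mathbb{R}^N$ is the family $\{\mathbf{T}_n\}_{0\le n<N}$ of vectors in $\mathbb{R}^N$,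 unique up to the sign of each vector, such that: (a) each $\mathbf{T}_n$ is an eigenvector of $\mathscr{F}$, with $\mathscr{F}\mathbf{T}_n=(-\mathrm{i})^n\mathbf{T}_n$ for $0\le n<N-1$; (b) $\{\mathbf{T}_n\}_{0\le n<N}$ is an orthonormal basis of $\mathbb{R}^N$; (c) $\operatorname{width}(\mathbf{T}_n)\le\lfloor(N+n+2)/4\rfloor$ for $0\le n<N$. (Existence and uniqueness up to signs hold for every $N\ge2$.) *)

(* Defs.v *)
From mathcomp Require Export all_boot all_order all_algebra.
From mathcomp Require Export reals trigo complex.
From mathcomp Require Import zify.
Set Implicit Arguments.
Unset Strict Implicit.
Unset Printing Implicit Defensive.
Import Order.TTheory GRing.Theory Num.Theory.
Local Open Scope ring_scope.
Local Open Scope complex_scope.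

(* A vector of K^N, identified with an N-periodic function on the integers,   *)
(* is a function on 'Z_N. This is only meaningful for 1 < N, since 'Z_0 and   *)
(* 'Z_1 are the integers modulo 2.                                            *)
Definition pervec (N : nat) (K : nzRingType) := {ffun 'Z_N -> K^o}.

(* The value at an integer k of the N-periodic function a. *)
Definition per (N : nat) (K : nzRingType) (a : pervec N K) (k : int) : K :=
  a k%:~R.

(* The centered index range -ceil(N/2)+1, ..., floor(N/2). *)
Definition I_ (N : nat) : seq int :=
  [seq i%:Z - (uphalf N)%:Z + 1 | i <- iota 0 N].

Lemma mem_I_ (N : nat) (k : int) :
  (k \in I_ N) = (- (uphalf N)%:Z + 1 <= k <= (N./2)%:Z).
Proof.
have EN : (uphalf N + N./2 = N)%N.
  by rewrite uphalf_half -addnA addnn odd_double_half.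
apply/mapP/idP => [[m] | k12].
  by rewrite mem_iota add0n => /= mN ->; lia.
by exists (absz (k + (uphalf N)%:Z - 1)%R); rewrite ?mem_iota; lia.
Qed.

(* The representative in I_ N of a residue class modulo N. *)
Definition centered (N : nat) (j : 'Z_N) : int :=
  if (j <= N./2)%N then j%:Z else j%:Z - N%:Z.

Lemma centered_I_ (N : nat) (j : 'Z_N) : (1 < N)%N -> centered j \in I_ N.
Proof.
move=> N1; have jN : (j < N)%N by rewrite -[X in (_ < X)%N](Zp_cast N1).
rewrite mem_I_ /centered.
have EN : (uphalf N + N./2 = N)%N.
  by rewrite uphalf_half -addnA addnn odd_double_half.
by have := uphalf_half N; case: (odd N); case: ifP; lia.
Qed.

Lemma centeredK (N : nat) (j : 'Z_N) : (1 < N)%N -> (centered j)%:~R = j.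
Proof.
move=> N1; rewrite /centered; case: ifP => _; first by rewrite -pmulrn natr_Zp.
by rewrite rmorphB /= -!pmulrn natr_Zp pchar_Zp // subr0.
Qed.

Definition dot (N : nat) (K : nzRingType) (a b : pervec N K) : K :=
  \sum_(k <- I_ N) per a k * per b k.

(* The norm of a real vector, for which conjugation is the identity. *)
Definition norm (R : realType) (N : nat) (a : pervec N R) : R :=
  Num.sqrt (dot a a).

Definition omega (R : realType) (N : nat) : R := 2 * pi / N%:R.

(* exp(i t), by Euler's formula *)
Definition expi (R : realType) (t : R) : R[i] := cos t +i* sin t.

Definition fourier (R : realType) (N : nat) (a : pervec N R[i]) :
    pervec N R[i] :=
  [ffun j : 'Z_N => let l := centered j in
    ((Num.sqrt N%:R : R)^-1)%:C *
    \sum_(k <- I_ N) expi (- (omega R N * k%:~R * l%:~R)) * per a k].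

Definition complexify (R : realType) (N : nat) (a : pervec N R) :
    pervec N R[i] :=
  [ffun j => (a j)%:C].

Definition eigenvector (R : realType) (N : nat)
    (F : pervec N R[i] -> pervec N R[i]) (v : pervec N R[i]) : Prop :=
  v != 0 /\ exists lambda : R[i], F v = lambda *: v.

Definition opL (R : realType) (N : nat) (a : pervec N R) : pervec N R :=
  [ffun j : 'Z_N => let k := centered j in
    per a (k + 1) + per a (k - 1) + 2 * cos (omega R N * k%:~R) * per a k].

Definition is_width (R : realType) (N : nat) (a : pervec N R) (n : nat) :
    Prop :=
  [/\ (n <= N./2)%N,
      per a n%:Z != 0 \/ per a (- n%:Z) != 0
    & forall k : int, n%:Z < `|k| <= (N./2)%:Z -> per a k = 0].

Definition minimal_hermite_basis (R : realType) (N : nat)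
    (T : N.-tuple (pervec N R)) : Prop :=
  [/\ forall n : nat, (n < N)%N ->
        eigenvector (@fourier R N) (complexify T`_n),
      forall n : nat, (n < N.-1)%N ->
        fourier (complexify T`_n) = (- 'i%C) ^+ n *: complexify T`_n,
      basis_of fullv T,
      forall m n : nat, (m < N)%N -> (n < N)%N ->
        dot T`_m T`_n = (m == n)%:R
    & forall n : nat, (n < N)%N ->
        exists2 w : nat, is_width T`_n w & (w <= (N + n + 2) %/ 4)%N].

(* The family T indexed by integers, with T_n = 0 for n < 0 and               *)
(* T_N = T_(N-1); it is also 0 for n > N.                                     *)
Definition extend (R : realType) (N : nat) (T : N.-tuple (pervec N R))
    (n : int) : pervec N R :=
  match n with
  | Posz m => if m == N then T`_N.-1 else T`_m
  | Negz _ => 0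
  end.

(* Main.v *)
Require Import Defs.
From mathcomp Require Import zify ring lra.
Set Implicit Arguments.
Unset Strict Implicit.
Unset Printing Implicit Defensive.
Import Order.TTheory GRing.Theory Num.Theory.
Local Open Scope ring_scope.

(** The operator L commutes with the Fourier transform F and is symmetric, so
    L T_k lies in the eigenspace of T_k and the numbers <L T_k, T_m> form a
    symmetric matrix whose entries vanish when T_k and T_m have different
    eigenvalues. The recurrence says that, in each eigenspace, this matrix is
    tridiagonal with nonzero off-diagonal entries, and both facts come from
    counting widths.

    The tool is an uncertainty principle. If a is supported on s consecutive
    residues and F a vanishes off [-w, w], then a, read as a polynomial of
    degree below s, has N - 2w - 1 distinct roots of unity as roots, so a = 0
    once s + 2w + 1 <= N ([uncertainty]). Hence the space E_w of the vectors v
    for which both v and F v are supported on [-w, w] has dimension at most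
    r = 4w + 2 - N: for r >= 0 the top r entries determine the vector, and for
    r < 0 the space is 0. The width condition puts T_0, ..., T_(r-1) into E_w,
    so they span it ([bandlimited_span]), and every vector of E_w is orthogonal
    to the remaining T_m ([bandlimited_orth]).

    Upper band ([opL_upper]): L increases the width by at most one, so L T_k is
    in E_(w+1), where w is the bound for the width of T_k. Therefore L T_k is
    orthogonal to T_m for m >= k + 8, where for even N the last vector counts
    as T_N. The eigenvalues exclude the indices from k + 5 to k + 7, and
    symmetry gives the lower band.

    Nonzero coefficient ([opL_raises]): if L T_k were a combination of the T_m
    with m <= k, its width would be at most w. But L raises a width w with
    2w + 2 <= N to w + 1 (for N = 2w + 2 this uses that T_k is even), so T_k
    would be supported on [-(w-1), w-1], hence lie in E_(w-1) and be orthogonal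
    to itself.

    The last vector T_(N-1) is only known to be some eigenvector. Its
    eigenvalue follows from [opL_raises] at the last index of the recurrence:
    the only T_m with m > k that may fail to be orthogonal to L T_k is then
    T_(N-1), so these two vectors share their eigenvalue
    ([fourier_index_eigen]). *)

(** * Characters of the integers modulo N *)

Section Characters.
Local Open Scope complex_scope.
Variables (R : realType).

Lemma expi0 : expi 0 = 1 :> R[i].
Proof. by rewrite /expi cos0 sin0. Qed.

Lemma expiD (s t : R) : expi (s + t) = expi s * expi t.
Proof.
rewrite /expi cosD sinD; congr (_ +i* _).
by rewrite addrC mulrC [sin s * _]mulrC.
Qed.

Lemma expi_neq0 (t : R) : expi t != 0.
Proof.
apply/eqP => e0; have := expiD t (- t).
by rewrite subrr expi0 e0 mul0r => /eqP; rewrite oner_eq0.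
Qed.

Lemma expiN (t : R) : expi (- t) = (expi t)^-1.
Proof.
apply: (mulfI (expi_neq0 t)); rewrite -expiD subrr expi0 divff //.
exact: expi_neq0.
Qed.

Lemma expiMn (t : R) (n : nat) : expi (t *+ n) = expi t ^+ n.
Proof. by elim: n => [|n IHn]; rewrite ?expi0 // mulrS exprS expiD IHn. Qed.

(** The real part is 1 - 2 sin^2(t/2), and sin(t/2) > 0 on the open period. *)
Lemma expi_neq1 (t : R) : 0 < t < pi *+ 2 -> expi t != 1.
Proof.
move=> tpi; have : 0 < sin (t / 2) by apply: sin_gt0_pi; lra.
apply: contraTneq => -[c1 _].
have := cos_mulr2n (t / 2); rewrite cos2sin2.
have -> : t / 2 *+ 2 = t by lra.
rewrite c1 => e; have /eqP : sin (t / 2) ^+ 2 = 0 by lra.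
by rewrite expf_eq0 /= => /eqP->; rewrite ltxx.
Qed.

Variables (N : nat) (hN : (2 <= N)%N).

(** A primitive N-th root of unity; its powers are the entries of the kernel
    exp(-i omega k l), which thereby becomes a function on 'Z_N. *)
Definition zeta : R[i] := expi (- omega R N).
Definition chi (j : 'Z_N) : R[i] := zeta ^+ j.

Lemma omegaMn : omega R N *+ N = pi *+ 2.
Proof.
rewrite -(mulr_natr (omega R N)) divfK ?mulr_natl //.
by rewrite pnatr_eq0; lia.
Qed.

Lemma zetaX : zeta ^+ N = 1.
Proof. by rewrite -expiMn mulNrn omegaMn expiN /expi cos2pi sin2pi invr1. Qed.

Lemma chi0 : chi 0 = 1.
Proof. by []. Qed.

Lemma chiD i j : chi (i + j) = chi i * chi j.
Proof.
rewrite /chi -exprD -[RHS](expr_mod _ zetaX).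
by congr (_ ^+ _) => /=; rewrite [X in (_ %% X)%N]Zp_cast.
Qed.

Lemma chi_neq0 j : chi j != 0.
Proof. by rewrite expf_neq0 // expi_neq0. Qed.

Lemma chiN j : chi (- j) = (chi j)^-1.
Proof.
by apply: (mulfI (chi_neq0 j)); rewrite -chiD subrr divff // chi_neq0.
Qed.

Lemma chiMn j n : chi (j *+ n) = chi j ^+ n.
Proof. by elim: n => [|n IHn]; rewrite ?chi0 // mulrS exprS chiD IHn. Qed.

Lemma chi_nat n : chi n%:R = zeta ^+ n.
Proof. by rewrite /chi val_Zp_nat // expr_mod // zetaX. Qed.

Lemma chi_int (k : int) : chi k%:~R = expi (- (omega R N * k%:~R)).
Proof.
case: k => n.
  by rewrite -pmulrn chi_nat -mulrN -expiMn -(mulr_natr (- _) n) mulNr mulrN.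
rewrite NegzE !rmorphN /= mulrN opprK chiN chi_nat -expiMn mulNrn expiN invrK.
by rewrite -(mulr_natr (omega R N)).
Qed.

Lemma chi_neq1 j : j != 0 -> chi j != 1.
Proof.
move=> j0; have jN : (j < N)%N by rewrite -[X in (_ < X)%N](Zp_cast hN).
have j_gt0 : (0 < j)%N.
  by rewrite lt0n; apply: contra_neq j0 => j0; apply: val_inj.
have oN := omegaMn.
have o0 : 0 < omega R N.
  by rewrite /omega !(mulr_gt0, invr_gt0, pi_gt0, ltr0n) //; lia.
rewrite /chi -expiMn mulNrn expiN invr_eq1 expi_neq1 //.
by rewrite -oN pmulrn_lgt0 // ltr_pMn2l // jN andbT.
Qed.

Lemma chi_inj : injective chi.
Proof.
move=> i j eij; apply/eqP; rewrite -subr_eq0; apply/negPn/negP => /chi_neq1.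
by rewrite chiD chiN eij divff ?eqxx // chi_neq0.
Qed.

(** Shifting the summation index by one multiplies the sum by chi j, which
    differs from 1 unless j = 0. *)
Lemma sum_chi j : \sum_(k : 'Z_N) chi (k * j) = (N%:R *+ (j == 0)).
Proof.
have [->|j0] := eqVneq j 0.
  under eq_bigr do rewrite mulr0.
  by rewrite sumr_const card_ord Zp_cast.
apply/eqP; rewrite mulr0n; have : (chi j - 1) * \sum_(k : 'Z_N) chi (k * j) = 0.
  rewrite mulrBl mul1r mulr_sumr [X in _ - X](reindex_inj (addIr 1)) /=.
  under [X in _ - X]eq_bigr do rewrite mulrDl mul1r addrC chiD.
  exact: subrr.
by move/eqP; rewrite mulf_eq0 subr_eq0 (negPf (chi_neq1 j0)).
Qed.

Lemma cos_chi (k : int) :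
  (2 * cos (omega R N * k%:~R))%:C = chi k%:~R + chi (- k%:~R).
Proof.
rewrite chiN chi_int -expiN opprK /expi cosN sinN.
by apply/eqP; rewrite eq_complex /= addNr eqxx andbT mulr_natl mulr2n.
Qed.

Lemma sum_I_ (V : nmodType) (f : 'Z_N -> V) :
  \sum_(k <- I_ N) f k%:~R = \sum_j f j.
Proof.
rewrite /I_ big_map -{1}[N]subn0 -/(index_iota 0 N) big_mkord.
case: N hN f => [|[|n]] // _ f.
rewrite [RHS](reindex_inj (addIr (1 - (uphalf n.+2)%:R))) /=.
apply: eq_bigr => i _; congr f.
by rewrite rmorphD rmorphB /= -!pmulrn natr_Zp -addrA addrC [1 + _]addrC addrC.
Qed.

End Characters.

(** * Fourier transform, reflection and the operator L *)

Section Bilinear.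
Variables (K : comNzRingType) (N : nat) (hN : (2 <= N)%N).
Implicit Types a b : pervec N K.

Lemma dotE a b : dot a b = \sum_j a j * b j.
Proof. by rewrite -(sum_I_ hN (fun j => a j * b j)). Qed.

Lemma dotC a b : dot a b = dot b a.
Proof. by rewrite !dotE; apply: eq_bigr => j _; rewrite mulrC. Qed.

Lemma dotDl a b c : dot (a + b) c = dot a c + dot b c.
Proof.
by rewrite !dotE -big_split; apply: eq_bigr => j _; rewrite ffunE mulrDl.
Qed.

Lemma dotZl x a b : dot (x *: a) b = x * dot a b.
Proof.
by rewrite !dotE mulr_sumr; apply: eq_bigr => j _; rewrite ffunE -mulrA.
Qed.

Lemma dotDr a b c : dot c (a + b) = dot c a + dot c b.
Proof. by rewrite dotC dotDl !(dotC c). Qed.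

Lemma dotZr x a b : dot b (x *: a) = x * dot b a.
Proof. by rewrite dotC dotZl dotC. Qed.

Lemma dot0l b : dot 0 b = 0.
Proof. by rewrite -(scale0r b) dotZl mul0r. Qed.

Lemma dot_suml I (r : seq I) (P : pred I) (f : I -> pervec N K) b :
  dot (\sum_(i <- r | P i) f i) b = \sum_(i <- r | P i) dot (f i) b.
Proof.
by elim/big_rec2: _ => [|i y1 y2 _ <-]; rewrite ?dot0l // dotDl.
Qed.
End Bilinear.

(** The entries with -w <= k <= w are the only ones that may be nonzero; the
    condition is stated on a full period so that it involves no case
    distinction on the parity of N or on the sign of k. *)
Definition supported (K : nzRingType) (N : nat) (a : pervec N K) (w : nat) :=
  forall k : int, w%:Z < k < N%:Z - w%:Z -> per a k = 0.

Section Fourier.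
Local Open Scope complex_scope.
Variables (R : realType) (N : nat) (hN : (2 <= N)%N).
Implicit Types (a b : pervec N R[i]) (v u : pervec N R).
Notation chi := (@chi R N).

Definition fourier_const : R[i] := ((Num.sqrt N%:R : R)^-1)%:C.

Lemma fourierE a j :
  fourier a j = fourier_const * \sum_(k : 'Z_N) chi (k * j) * a k.
Proof.
rewrite ffunE -(sum_I_ hN (fun k => chi (k * j) * a k)); congr (_ * _).
apply: eq_bigr => k _; rewrite -mulrA -intrM -chi_int // intrM centeredK //.
Qed.

Lemma fourier_const2 : fourier_const ^+ 2 * N%:R = 1.
Proof.
have N0 : (N%:R : R) != 0 by rewrite pnatr_eq0; lia.
rewrite /fourier_const -rmorphXn exprVn sqr_sqrtr ?ler0n //.
by rewrite -(rmorph_nat (real_complex R)) -rmorphM /= mulVf.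
Qed.

Lemma fourier_const_neq0 : fourier_const != 0.
Proof.
apply/eqP => c0; have /eqP := fourier_const2.
by rewrite c0 expr0n mul0r eq_sym oner_eq0.
Qed.

Lemma fourierD a b : fourier (a + b) = fourier a + fourier b.
Proof.
apply/ffunP => j; rewrite [in RHS]ffunE !fourierE -mulrDr -big_split /=.
by congr (_ * _); apply: eq_bigr => k _; rewrite ffunE mulrDr.
Qed.

Lemma fourierZ x a : fourier (x *: a) = x *: fourier a.
Proof.
apply/ffunP => j; rewrite [in RHS]ffunE !fourierE [RHS]mulrCA; congr (_ * _).
rewrite mulr_sumr; apply: eq_bigr => k _; rewrite ffunE mulrCA //.
Qed.

(** The kernel chi (k * l) is symmetric; there is no conjugation in dot. *)
Lemma dot_fourier a b : dot (fourier a) b = dot a (fourier b).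
Proof.
rewrite !dotE //.
under eq_bigr do rewrite fourierE -mulrA mulr_suml.
under [RHS]eq_bigr do rewrite fourierE mulrCA mulr_sumr.
rewrite -!mulr_sumr exchange_big /=; congr (_ * _).
apply: eq_bigr => k _; apply: eq_bigr => j _.
by rewrite [k * j]mulrC; ring.
Qed.

Lemma fourier2 a j : fourier (fourier a) j = a (- j).
Proof.
rewrite fourierE; under eq_bigr do rewrite fourierE mulrCA mulr_sumr.
rewrite -mulr_sumr mulrA exchange_big /=.
transitivity (fourier_const ^+ 2 * \sum_i a i * \sum_k chi (k * (i + j))).
  rewrite expr2; congr (_ * _); apply: eq_bigr => i _; rewrite mulr_sumr.
  apply: eq_bigr => k _; rewrite mulrDr chiD // [i * k]mulrC; ring.
under eq_bigr do rewrite sum_chi //.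
rewrite (bigD1 (- j)) //= addNr eqxx mulr1n big1 => [|i ij].
  by rewrite addr0 mulrCA fourier_const2 mulr1.
by rewrite -addr_eq0 in ij; rewrite (negPf ij) mulr0n mulr0.
Qed.

Lemma dot_complexify v u :
  dot (complexify v) (complexify u) = (dot v u)%:C.
Proof.
rewrite !dotE // rmorph_sum; apply: eq_bigr => j _.
by rewrite !ffunE -rmorphM.
Qed.

Lemma complexifyD v u : complexify (v + u) = complexify v + complexify u.
Proof. by apply/ffunP => j; rewrite !ffunE -rmorphD. Qed.

Lemma complexifyZ x v : complexify (x *: v) = x%:C *: complexify v.
Proof. by apply/ffunP => j; rewrite !ffunE -[RHS]rmorphM. Qed.

Definition fourier_eigen (lambda : R[i]) v :=
  fourier (complexify v) = lambda *: complexify v.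

(** By the symmetry of F for the bilinear form,
    lambda <v, u> = <F v, u> = <v, F u> = mu <v, u>. *)
Lemma eigen_orthogonal lambda mu v u :
  fourier_eigen lambda v -> fourier_eigen mu u -> lambda != mu -> dot v u = 0.
Proof.
move=> Fv Fu; rewrite -subr_eq0 => lm; apply: complexI; apply: (mulfI lm).
rewrite mulr0 -dot_complexify mulrBl -(dotZl hN) -(dotZr hN) -Fv -Fu.
by rewrite dot_fourier subrr.
Qed.

(** F^2 is the reflection j |-> -j, so eigenvectors for 1 and -1 are even. *)
Lemma eigen_reflect lambda v j :
  fourier_eigen lambda v -> lambda ^+ 2 = 1 -> v (- j) = v j.
Proof.
move=> Fv l2; apply: complexI; have := fourier2 (complexify v) j.
by rewrite Fv fourierZ Fv scalerA -expr2 l2 scale1r !ffunE.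
Qed.

Lemma opLE v j : opL v j =
  v (j + 1) + v (j - 1) + 2 * cos (omega R N * (centered j)%:~R) * v j.
Proof. by rewrite ffunE /per rmorphB rmorphD /= centeredK. Qed.

Lemma dot_opL v u : dot (opL v) u = dot v (opL u).
Proof.
rewrite !dotE //.
under eq_bigr do rewrite opLE 2!mulrDl.
under [RHS]eq_bigr do rewrite opLE !mulrDr.
rewrite !big_split /=; congr (_ + _); last first.
  by apply: eq_bigr => j _; ring.
rewrite addrC; congr (_ + _).
  rewrite [LHS](reindex_inj (addIr 1)) /=.
  by apply: eq_bigr => j _; rewrite addrK.
rewrite [RHS](reindex_inj (addIr 1)) /=.
by apply: eq_bigr => j _; rewrite addrK.
Qed.

Lemma complexify_opL v j : complexify (opL v) j =
  complexify v (j + 1) + complexify v (j - 1) +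
    (chi j + chi (- j)) * complexify v j.
Proof.
rewrite ffunE opLE !ffunE !rmorphD rmorphM /= cos_chi //.
by rewrite centeredK.
Qed.

(** L = S + M, where S adds the two neighbouring values and M multiplies by
    2 cos(omega j) = chi j + chi (- j). F exchanges S and M, so it commutes
    with L. *)
Lemma eigen_opL lambda v :
  fourier_eigen lambda v -> fourier_eigen lambda (opL v).
Proof.
move=> Fv; apply/ffunP => j; rewrite [RHS]ffunE complexify_opL.
have Fj i : lambda * complexify v i = fourier (complexify v) i.
  by rewrite Fv [RHS]ffunE.
rewrite [RHS]mulrDr [X in _ = X + _]mulrDr [X in _ = _ + X]mulrCA !Fj !fourierE.
under eq_bigr do rewrite complexify_opL !mulrDr.
rewrite !big_split /= (reindex_inj (addIr (-1))) /=.
rewrite [X in _ * (_ + X + _)](reindex_inj (addIr 1)) /=.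
rewrite -mulrDr -big_split /= mulrCA -mulrDr; congr (_ * _).
rewrite -big_split mulr_sumr -!big_split; apply: eq_bigr => k _ /=.
rewrite addrK subrK !(mulrDl _ _ j) !(mulrDr k) mulr1 mul1r mulrN1 mulN1r.
by rewrite !chiD //; ring.
Qed.

End Fourier.

(** * Supports and the uncertainty principle *)

Section Support.
Variables (K : nzRingType) (N : nat).
Implicit Types (a : pervec N K) (k : int).

Lemma perDN a k : (2 <= N)%N -> per a (k + N%:Z) = per a k.
Proof.
by move=> hN; rewrite /per rmorphD /= -[N%:Z%:~R]pmulrn pchar_Zp ?addr0.
Qed.

Lemma supportedD a b w :
  supported a w -> supported b w -> supported (a + b) w.
Proof.
by move=> sa sb k kw; rewrite /per ffunE [a _]sa // [b _]sb // addr0.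
Qed.

Lemma supportedZ x a w : supported a w -> supported (x *: a) w.
Proof. by move=> sa k kw; rewrite /per ffunE [a _]sa // scaler0. Qed.

Lemma supported_sum I (r : seq I) (P : pred I) (f : I -> pervec N K) w :
  (forall i, P i -> supported (f i) w) ->
  supported (\sum_(i <- r | P i) f i) w.
Proof.
move=> sf; elim/big_rec: _ => [k _|i a Pi sa]; first by rewrite /per ffunE.
by apply: supportedD => //; apply: sf.
Qed.

Lemma supportedW a w w' : (w <= w')%N -> supported a w -> supported a w'.
Proof. by move=> ww' sa k kw; apply: sa; lia. Qed.

End Support.

Lemma width_supported (R : realType) (N : nat) (hN : (2 <= N)%N)
    (v : pervec N R) n :
  is_width v n -> supported v n.
Proof.
case=> nN _ v0 k kw; have [kN|kN] := leP k (N./2)%:Z; first by apply: v0; lia.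
by rewrite -(subrK N%:Z k) perDN //; apply: v0; lia.
Qed.

Section Uncertainty.
Local Open Scope complex_scope.
Variables (R : realType) (N : nat) (hN : (2 <= N)%N).

(** Up to the unit chi (- (w * l)), the value of F a at l is the value at
    chi l of the polynomial whose coefficients are the entries of a listed from
    position -w. F a vanishes at the N - 2w - 1 residues outside [-w, w], so
    this polynomial has at least as many roots as coefficients. *)
Lemma uncertainty (a : pervec N R[i]) (s w : nat) :
    (s + 2 * w + 1 <= N)%N ->
    (forall i : nat, (s <= i < N)%N -> per a (i%:Z - w%:Z) = 0) ->
  supported (fourier a) w -> a = 0.
Proof.
move=> swN a0 Fa0.
pose p := \poly_(i < s) per a (i%:Z - w%:Z).
have p_root (l : nat) : (w < l < N - w)%N -> root p (chi R (l%:R : 'Z_N)).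
  move=> lw; have : per (fourier a) l%:Z = 0 by apply: Fa0; lia.
  rewrite /per fourierE // => /eqP.
  rewrite mulf_eq0 (negPf (fourier_const_neq0 _ hN)) /= => /eqP F0.
  rewrite /root horner_poly; apply/eqP.
  apply: (mulfI (chi_neq0 R (- (w%:R * l%:R)))); rewrite mulr0 -{}[RHS]F0.
  rewrite [RHS](reindex_inj (addIr (- w%:R))) /=.
  pose g (i : nat) := chi R ((i%:R - w%:R) * l%:R : 'Z_N) * per a (i%:Z - w%:Z).
  transitivity (\sum_(0 <= i < N) g i); last first.
    rewrite -{1}(Zp_cast hN) big_mkord; apply: eq_bigr => i _.
    by rewrite /g /per rmorphB /= -!pmulrn natr_Zp.
  rewrite (big_cat_nat _ (n := s)) //=; last by lia.
  rewrite [X in _ + X]big_nat_cond [X in _ + X]big1 ?addr0; last first.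
    by move=> i; rewrite andbT => si; rewrite /g a0 ?mulr0.
  rewrite big_mkord mulr_sumr; apply: eq_bigr => i _.
  have chi_il : chi R ((i%:R - w%:R) * l%:R : 'Z_N) =
      chi R (- (w%:R * l%:R) : 'Z_N) * chi R (l%:R : 'Z_N) ^+ i.
    by rewrite -(chiMn R hN) -(chiD R hN) mulrBl (mulr_natl _ i) addrC.
  by rewrite /g chi_il -mulrA [per _ _ * _]mulrC.
pose rs := [seq chi R (l%:R : 'Z_N) | l <- iota w.+1 (N - 2 * w - 1)].
have p0 : p = 0.
  apply: (@roots_geq_poly_eq0 _ p rs).
  - apply/allP => _ /mapP[l + ->]; rewrite mem_iota => lw; apply: p_root; lia.
  - rewrite map_inj_in_uniq ?iota_uniq // => l l'; rewrite !mem_iota => lw lw'.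
    move=> /(chi_inj hN) /(congr1 val) /=.
    rewrite !val_Zp_nat // !modn_small //.
      lia.
    lia.
  - rewrite size_map size_iota; apply: leq_trans (size_poly _ _) _; lia.
apply/ffunP => j; rewrite [RHS]ffunE -(subrK w%:R j) addrAC.
set z := (X in a (X - _)); pose i : nat := z.
have iN : (i < N)%N by rewrite -[X in (_ < X)%N](Zp_cast hN); apply: ltn_ord.
have -> : z - w%:R = (i%:Z - w%:Z)%:~R.
  by rewrite rmorphB /= -!pmulrn natr_Zp.
have [si|si] := leqP s i; first by apply: a0; rewrite si.
by have /polyP/(_ i) := p0; rewrite coef_poly si coef0.
Qed.
End Uncertainty.

Section BandLimited.
Local Open Scope complex_scope.
Variables (R : realType) (N : nat) (hN : (2 <= N)%N).
Implicit Types v u : pervec N R.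

Definition bandlimited v w :=
  supported v w /\ supported (fourier (complexify v)) w.

Lemma eigen_bandlimited lambda v w :
  fourier_eigen lambda v -> supported v w -> bandlimited v w.
Proof.
move=> Fv sv; split=> //; rewrite Fv; apply: supportedZ => k kw.
by rewrite /per ffunE [v _]sv.
Qed.

Lemma bandlimitedD v u w :
  bandlimited v w -> bandlimited u w -> bandlimited (v + u) w.
Proof.
case=> sv sFv [su sFu]; split; first exact: supportedD.
by rewrite complexifyD fourierD //; apply: supportedD.
Qed.

Lemma bandlimitedZ x v w : bandlimited v w -> bandlimited (x *: v) w.
Proof.
case=> sv sFv; split; first exact: supportedZ.
by rewrite complexifyZ fourierZ //; apply: supportedZ.
Qed.

Lemma bandlimited0 w : bandlimited (0 : pervec N R) w.
Proof.
split=> [k _|]; first by rewrite /per ffunE.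
have -> : complexify (0 : pervec N R) = 0 by apply/ffunP => j; rewrite !ffunE.
by rewrite -(scale0r 0) fourierZ // scale0r => k _; rewrite /per ffunE.
Qed.

Lemma bandlimited_sum I (r : seq I) (P : pred I) (f : I -> pervec N R) w :
  (forall i, P i -> bandlimited (f i) w) ->
  bandlimited (\sum_(i <- r | P i) f i) w.
Proof.
move=> bf; elim/big_rec: _ => [|i v Pi bv]; first exact: bandlimited0.
by apply: bandlimitedD => //; apply: bf.
Qed.

(** For 4w + 2 >= N, once its top 4w + 2 - N entries vanish, v is supported on
    N - 2w - 1 consecutive residues, the largest number that [uncertainty]
    allows; for 4w + 2 < N the window of 2w + 1 residues is small enough. *)
Lemma bandlimited_eq0 v w : (2 * w < N)%N -> bandlimited v w ->
  (forall i : nat, (i < 4 * w + 2 - N)%N -> per v (w%:Z - i%:Z) = 0) -> v = 0.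
Proof.
move=> wN [sv sFv] v0.
have cv0 : complexify v = 0.
  (* The window has 2w + 1 entries, of which the top 4w + 2 - N vanish. *)
  apply: (uncertainty hN (s := 2 * w + 1 - (4 * w + 2 - N)) _ _ sFv); first lia.
  move=> i iN; rewrite /per ffunE.
  apply/eqP; rewrite (fmorph_eq0 (real_complex R)).
  have [iw|iw] := leqP i (2 * w); last by rewrite [v _]sv //; lia.
  have -> : i%:Z - w%:Z = w%:Z - (2 * w - i)%:Z by lia.
  by rewrite [v _]v0 //; lia.
apply/ffunP => j; apply: complexI.
by have /ffunP/(_ j) := cv0; rewrite !ffunE.
Qed.

(** The dimension bound in the form that is used. Taking the top entries embeds
    the span of v and the T i into R^r, r = 4w + 2 - N, and the r independent
    vectors T i have independent images there, so these images form a basis of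
    R^r. For r = 0 this says that v = 0. *)
Lemma bandlimited_span w (T : 'I_(4 * w + 2 - N) -> pervec N R) v :
    (2 * w < N)%N ->
    (forall i j, dot (T i) (T j) = (i == j)%:R) ->
    (forall i, bandlimited (T i) w) ->
  bandlimited v w -> exists x : 'I_(4 * w + 2 - N) -> R, v = \sum_i x i *: T i.
Proof.
move=> wN Torth Tb vb; set r := (4 * w + 2 - N)%N in T Torth Tb *.
(* The top entries of u, listed downwards from position w. *)
pose phi u : 'rV[R]_r := \row_(i < r) per u (w%:Z - (i : nat)%:Z).
have phi_sum (x : 'I_r -> R) (y : R) :
    phi (y *: v - \sum_i x i *: T i) =
    y *: phi v - (\row_i x i) *m (\matrix_(i < r) phi (T i)).
  apply/rowP => j; rewrite !mxE /per !ffunE sum_ffunE; congr (_ - _).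
  by apply: eq_bigr => i _; rewrite !mxE ffunE.
have phi_inj (x : 'I_r -> R) (y : R) :
    phi (y *: v - \sum_i x i *: T i) = 0 -> y *: v = \sum_i x i *: T i.
  move=> phi0; apply/eqP; rewrite -subr_eq0; apply/eqP.
  apply: (@bandlimited_eq0 _ w) => //.
    apply: bandlimitedD; first exact: bandlimitedZ.
    rewrite -scaleN1r; apply/bandlimitedZ/bandlimited_sum => i _.
    exact: bandlimitedZ.
  by move=> i ir; have /rowP/(_ (Ordinal ir)) := phi0; rewrite !mxE.
pose M := \matrix_(i < r) phi (T i).
have Mu : M \in unitmx.
  rewrite -row_free_unit; apply/inj_row_free => x xM.
  have := phi_inj (x 0) 0; rewrite phi_sum !scale0r sub0r.
  have -> : \row_i x 0 i = x by apply/rowP => i; rewrite mxE.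
  rewrite xM oppr0 => /(_ erefl) /esym x0; apply/rowP => j.
  have := congr1 (fun u => dot u (T j)) x0; rewrite dot0l // dot_suml //.
  rewrite (bigD1 j) //= dotZl // Torth eqxx mulr1 big1 ?addr0 ?mxE // => i ij.
  by rewrite dotZl // Torth (negPf ij) mulr0.
exists ((phi v *m invmx M) 0); rewrite -[v in LHS]scale1r; apply: phi_inj.
rewrite phi_sum scale1r.
have -> : \row_i (phi v *m invmx M) 0 i = phi v *m invmx M.
  by apply/rowP => i; rewrite mxE.
by rewrite mulmxKV // subrr.
Qed.

End BandLimited.

Section Laplacian.
Variables (R : realType) (N : nat) (hN : (2 <= N)%N).
Implicit Types v u : pervec N R.

Lemma per_opL v (k : int) :
  exists c, per (opL v) k = per v (k + 1) + per v (k - 1) + c * per v k.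
Proof.
by eexists; rewrite /per opLE // rmorphD rmorphB /=.
Qed.

Lemma opL_supported v w : supported v w -> supported (opL v) w.+1.
Proof.
move=> sv k kw; have [c ->] := per_opL v k.
by rewrite !sv ?addr0 ?mulr0 ?addr0 //; lia.
Qed.

(** At position w + 1, L v takes the value v(w) + v(w + 2), and v(w + 2) = 0
    unless w + 2 and -w are the same residue, that is, N = 2w + 2. In that case
    the value is v(w) + v(-w), and evenness is what keeps the terms from
    cancelling. *)
Lemma opL_widens v w : (2 * w + 2 <= N)%N -> (0 < w)%N ->
    (N = 2 * w + 2 -> forall j, v (- j) = v j)%N ->
  supported v w -> supported (opL v) w -> supported v w.-1.
Proof.
move=> wN w0 v_even sv sLv.
have vw0 : per v w%:Z = 0 /\ per v (- w%:Z) = 0.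
  have [NE|NE] := eqVneq N (2 * w + 2)%N.
    have vE : per v (- w%:Z) = per v w%:Z by rewrite /per rmorphN v_even.
    rewrite vE; suff -> : per v w%:Z = 0 by [].
    have : per (opL v) (w%:Z + 1) = 0 by apply: sLv; lia.
    have [c ->] := per_opL v (w%:Z + 1).
    rewrite addrK (sv (w%:Z + 1)) ?mulr0 ?addr0; last lia.
    have -> : w%:Z + 1 + 1 = - w%:Z + N%:Z by lia.
    by rewrite perDN // vE => ?; lra.
  split.
    have : per (opL v) (w%:Z + 1) = 0 by apply: sLv; lia.
    have [c ->] := per_opL v (w%:Z + 1).
    rewrite addrK !(sv (w%:Z + 1), sv (w%:Z + 1 + 1)); try lia.
    by rewrite mulr0 addr0 add0r.
  rewrite -perDN //.
  have : per (opL v) (- w%:Z + N%:Z - 1) = 0 by apply: sLv; lia.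
  have [c ->] := per_opL v (- w%:Z + N%:Z - 1).
  rewrite subrK (sv (- w%:Z + N%:Z - 1 - 1)) ?addr0; last lia.
  by rewrite (sv (- w%:Z + N%:Z - 1)) ?mulr0 ?addr0 //; lia.
case: vw0 => vw vNw k kw.
have [->//|kw'] := eqVneq k w%:Z.
have [->|kw''] := eqVneq k (- w%:Z + N%:Z); first by rewrite perDN.
by apply: sv; lia.
Qed.

End Laplacian.

(** * The matrix of L in a minimal Hermite-type basis *)

Section PowersOfI.
Local Open Scope complex_scope.
Variable R : rcfType.

Lemma expNi_mod4 n : (- 'i%C : R[i]) ^+ n = (- 'i%C) ^+ (n %% 4).
Proof.
rewrite expr_mod // (_ : 4 = 2 * 2)%N // exprM.
by rewrite sqrrN sqr_i sqrrN expr1n.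
Qed.

Lemma expNi_inj m n :
  (- 'i%C : R[i]) ^+ m = (- 'i%C) ^+ n -> (m %% 4 = n %% 4)%N.
Proof.
rewrite expNi_mod4 [RHS]expNi_mod4.
case: (m %% 4)%N (ltn_pmod m (isT : 0 < 4)%N) => [|[|[|[|]]]] // _;
case: (n %% 4)%N (ltn_pmod n (isT : 0 < 4)%N) => [|[|[|[|]]]] // _;
rewrite ?exprS ?expr0 ?mulr1 => /eqP; rewrite eq_complex /=;
rewrite ?(mulr0, mul0r, mulr1, mul1r, oppr0, subr0, add0r, addr0, sub0r, opprK,
          mulrN1, mulN1r) => /andP[/eqP ? /eqP ?];
by [] || (exfalso; lra).
Qed.
End PowersOfI.

Section HermiteBasis.
Local Open Scope complex_scope.
Variables (R : realType) (N : nat) (hN : (2 <= N)%N).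
Variables (T : N.-tuple (pervec N R)) (hT : minimal_hermite_basis T).
Implicit Types v u : pervec N R.

Lemma hermite_orth m n :
  (m < N)%N -> (n < N)%N -> dot T`_m T`_n = (m == n)%:R.
Proof. by case: hT => _ _ _ orth _; apply: orth. Qed.

Lemma hermite_supported n : (n < N)%N -> supported T`_n ((N + n + 2) %/ 4).
Proof.
case: hT => _ _ _ _ wd /wd[w /(width_supported hN) sT wn].
exact: supportedW sT.
Qed.

Lemma hermite_eigen n : (n < N.-1)%N -> fourier_eigen ((- 'i%C) ^+ n) T`_n.
Proof. by case: hT => _ eig _ _ _; apply: eig. Qed.

Lemma hermite_some_eigen n :
  (n < N)%N -> exists lambda, fourier_eigen lambda T`_n.
Proof. by case: hT => eig _ _ _ _ /eig[]. Qed.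

Lemma hermite_expand v : v = \sum_(i < N) dot v T`_i *: T`_i.
Proof.
case: hT => _ _ base _ _.
rewrite [LHS](coord_basis base (memvf v)); apply: eq_bigr => i _.
rewrite {2}(coord_basis base (memvf v)) dot_suml // (bigD1 i) //=.
rewrite dotZl // hermite_orth // eqxx mulr1 big1 ?addr0 // => j ji.
by rewrite dotZl // hermite_orth // val_eqE (negPf ji) mulr0.
Qed.

Lemma hermite_ext v u :
  (forall m, (m < N)%N -> dot v T`_m = dot u T`_m) -> v = u.
Proof.
move=> vu; rewrite (hermite_expand v) (hermite_expand u).
by apply: eq_bigr => i _; rewrite vu.
Qed.

(** The width bound (N + i + 2) / 4 is at most w exactly when i < 4w + 2 - N, so
    the vectors T_i that it places in the band-limited space are as many as
    [bandlimited_span] asks for. *)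
Lemma bandlimited_orth v w m : (2 * w + 2 <= N)%N -> bandlimited v w ->
  (4 * w + 2 - N <= m < N)%N -> dot v T`_m = 0.
Proof.
move=> wN vb /andP[rm mN].
have [|i j|i|x ->] := @bandlimited_span R N hN w (fun i => T`_i) v _ _ _ vb.
- lia.
- by have := (ltn_ord i, ltn_ord j) => -[iN jN]; rewrite hermite_orth //; lia.
- have [|lambda Ti] := @hermite_some_eigen i; first by have := ltn_ord i; lia.
  apply: (eigen_bandlimited Ti).
  by apply: supportedW (hermite_supported _); have := ltn_ord i; lia.
rewrite dot_suml // big1 // => i _.
have iN : (i < 4 * w + 2 - N)%N := ltn_ord i.
have im : (i == m :> nat) = false by lia.
by rewrite dotZl // hermite_orth ?im ?mulr0 //; lia.
Qed.

Definition admissible k :=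
  [|| k + 5 < N, odd N && (k + 5 == N) | ~~ odd N && (k + 4 == N)]%N.

(** If L T_k were a combination of T_0, ..., T_k, its width would be within the
    bound w for T_k. Then [opL_widens] lowers the width of T_k to w - 1, and
    [bandlimited_orth] makes T_k orthogonal to itself. *)
Lemma opL_raises k : admissible k ->
  ~ (forall m, (k < m < N)%N -> dot (opL T`_k) T`_m = 0).
Proof.
move=> rk LT0; set w := ((N + k + 2) %/ 4)%N.
have kN : (k < N.-1)%N by move: rk; rewrite /admissible; lia.
have sT : supported T`_k w by apply: hermite_supported; lia.
have sLT : supported (opL T`_k) w.
  rewrite (hermite_expand (opL _)); apply: supported_sum => i _.
  have [ki|ik] := ltnP k i.
    by rewrite LT0 ?ki ?ltn_ord // scale0r => z _; rewrite /per ffunE.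
  apply: supportedZ; apply: supportedW (hermite_supported (ltn_ord i)).
  by rewrite /w; lia.
have sT1 : supported T`_k w.-1.
  apply: (opL_widens hN _ _ _ sT sLT).
  - by move: rk; rewrite /admissible /w; lia.
  - by rewrite /w; lia.
  move=> Nw j; apply: eigen_reflect (hermite_eigen kN) _ => //.
  rewrite exprAC sqrrN sqr_i -signr_odd.
  have -> : odd k = false by move: rk; rewrite /admissible /w in Nw *; lia.
  by rewrite expr0.
have : dot T`_k T`_k = 0.
  apply: (@bandlimited_orth _ w.-1 k).
  - by move: rk; rewrite /admissible /w; lia.
  - exact: eigen_bandlimited (hermite_eigen kN) sT1.
  - by move: rk; rewrite /admissible /w; lia.
by rewrite hermite_orth ?eqxx; [move/eqP; rewrite oner_eq0 | lia | lia].
Qed.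

(** The exponent n for which T_m has eigenvalue (-i)^n. In the last place it
    skips N - 1 when N is even, since T_(N-1) then stands for T_N. *)
Definition fourier_index m := if (m < N.-1)%N then m else (N./2).*2.

(** The case m = N - 1. Let k be the last index of the
    recurrence. The T_m with k < m < N - 1 are orthogonal to L T_k, having
    another eigenvalue; if the eigenvalue of T_(N-1) differed from (-i)^k, it
    would be orthogonal as well, against [opL_raises]. *)
Lemma fourier_index_eigen m : (4 <= N)%N -> (m < N)%N ->
  fourier_eigen ((- 'i%C) ^+ fourier_index m) T`_m.
Proof.
move=> N4 mN; rewrite /fourier_index; case: ifP => [/hermite_eigen //|mN1].
have -> : m = N.-1 by lia.
have [|lambda FT] := @hermite_some_eigen N.-1; first lia.
pose k := ((N./2).*2 - 4)%N.
have -> : (N./2).*2 = (k + 4)%N by rewrite /k; lia.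
rewrite expNi_mod4 modnDr -expNi_mod4.
have [<- //|lk] := eqVneq lambda ((- 'i%C) ^+ k).
have kN : (k < N.-1)%N by rewrite /k; lia.
have rk : admissible k by rewrite /admissible /k; lia.
have FLT := eigen_opL hN (hermite_eigen kN).
case: (opL_raises rk) => j kj.
have [jN|jN] := ltnP j N.-1; last first.
  have -> : j = N.-1 by lia.
  by apply: eigen_orthogonal FLT FT _ => //; rewrite eq_sym.
apply: eigen_orthogonal FLT (hermite_eigen jN) _ => //.
by apply/eqP => /expNi_inj; rewrite /k in kj *; lia.
Qed.

Lemma opL_class k m : (4 <= N)%N -> (k < N.-1)%N -> (m < N)%N ->
  k != fourier_index m %[mod 4] -> dot (opL T`_k) T`_m = 0.
Proof.
move=> N4 kN mN km.
have FLT := eigen_opL hN (hermite_eigen kN).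
apply: (eigen_orthogonal hN FLT (fourier_index_eigen N4 mN)).
by apply: contra_neq km => /expNi_inj.
Qed.

(** Equality of eigenvalues forces the index of T_m to be at least k + 8, and
    L T_k is band-limited to w + 1, where w = (N + k + 2) / 4. By
    [bandlimited_orth] it is orthogonal to all T_m with m >= 4w + 6 - N, and
    this bound is at most k + 8. For m = N - 1 the bound is at most N - 2. *)
Lemma opL_upper k m : (4 <= N)%N -> (k < N.-1)%N -> (m < N)%N ->
  (k + 4 < fourier_index m)%N -> dot (opL T`_k) T`_m = 0.
Proof.
move=> N4 kN mN km.
have [cl|] := eqVneq (k %% 4)%N (fourier_index m %% 4)%N; last first.
  exact: opL_class.
have km8 : (k + 8 <= fourier_index m)%N by lia.
apply: (@bandlimited_orth _ ((N + k + 2) %/ 4).+1).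
- by move: km8; rewrite /fourier_index; case: ifP => ? ?; lia.
- apply: eigen_bandlimited (eigen_opL hN (hermite_eigen kN)) _.
  by apply: opL_supported => //; apply: hermite_supported; lia.
- by move: km8; rewrite /fourier_index; case: ifP => ? ?; lia.
Qed.

End HermiteBasis.

(** * The three-term recurrence *)

Lemma sqr_norm (R : realType) (N : nat) (hN : (2 <= N)%N) (v : pervec N R) :
  norm v ^+ 2 = dot v v.
Proof.
rewrite sqr_sqrtr // dotE //; apply: sumr_ge0 => j _.
by rewrite -expr2 sqr_ge0.
Qed.

Section Recurrence.
Variables (R : realType) (N : nat) (hN : (2 <= N)%N).
Variables (T : N.-tuple (pervec N R)) (hT : minimal_hermite_basis T).

Lemma extend_nat k : (k < N)%N -> extend T k%:Z = T`_k.
Proof. by move=> kN /=; rewrite (_ : k == N = false) //; lia. Qed.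

Lemma extend_neg (n : int) : n < 0 -> extend T n = 0.
Proof. by case: n => // n; lia. Qed.

(** The position in the tuple of the vector called T_(k+4), in which T_N is
    T_(N-1). *)
Definition succ_index k := if (k + 5 < N)%N then (k + 4)%N else N.-1.

Lemma extend_succ k :
  admissible N k -> extend T (k%:Z + 4) = T`_(succ_index k).
Proof.
rewrite /admissible /succ_index => rk.
rewrite (_ : k%:Z + 4 = (k + 4)%:Z); last lia.
rewrite /extend; case: eqP; case: ifP => // ? ?; try lia.
by congr T`_ _; lia.
Qed.

Definition coef_a (n : int) : R := dot (opL (extend T n)) (extend T n).
Definition coef_b (n : int) : R :=
  if n < 0 then 0 else dot (opL (extend T n)) (extend T (n + 4)).

Lemma coef_b_succ k : admissible N k ->
  coef_b k%:Z = dot (opL T`_k) T`_(succ_index k).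
Proof.
move=> rk; rewrite /coef_b (_ : k%:Z < 0 = false) // extend_succ //.
by rewrite extend_nat //; move: rk; rewrite /admissible; lia.
Qed.

Lemma coef_b_prev k : admissible N k ->
  coef_b (k%:Z - 4) = dot (opL T`_k) (extend T (k%:Z - 4)).
Proof.
move=> rk; have kN : (k < N)%N by move: rk; rewrite /admissible; lia.
rewrite /coef_b; case: ifP => k4.
  by rewrite dotC // extend_neg ?dot0l.
by rewrite subrK extend_nat // dot_opL // dotC.
Qed.

Lemma dot_extend_prev k m : (k < N)%N -> (m < N)%N ->
  dot (extend T (k%:Z - 4)) T`_m = (m + 4 == k)%N%:R.
Proof.
move=> kN mN; have [k4|k4] := leqP 4 k.
  rewrite (_ : k%:Z - 4 = (k - 4)%:Z); last lia.
  rewrite extend_nat ?hermite_orth //; try lia.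
  by congr (_%:R); lia.
rewrite (_ : m + 4 == k = false)%N; last lia.
by rewrite extend_neg ?dot0l //; lia.
Qed.

(** Both sides have the same coordinates: outside k - 4, k and k + 4, those of
    L T_k vanish by the eigenvalues, by [opL_upper], or by [opL_upper] with the
    two indices exchanged through the symmetry of L. *)
Lemma opL_three_terms k : admissible N k ->
  opL T`_k = coef_a k%:Z *: T`_k + coef_b (k%:Z - 4) *: extend T (k%:Z - 4)
    + coef_b k%:Z *: T`_(succ_index k).
Proof.
move=> rk; have kN : (k < N.-1)%N by move: rk; rewrite /admissible; lia.
have N4 : (4 <= N)%N by move: rk; rewrite /admissible; lia.
have succN : (succ_index k < N)%N by rewrite /succ_index; case: ifP; lia.
apply: (hermite_ext hN hT) => m mN.
rewrite !(dotDl hN) !(dotZl hN) dot_extend_prev //; last lia.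
rewrite !(hermite_orth hT) //; last lia.
rewrite coef_b_succ // coef_b_prev // /coef_a extend_nat; last lia.
have [mk|mk] := eqVneq k m.
  rewrite -mk (_ : k + 4 == k = false)%N; last lia.
  rewrite (_ : succ_index k == k = false)%N; last first.
    by rewrite /succ_index; case: ifP; lia.
  by rewrite mulr1 !mulr0 !addr0.
have [mk4|mk4] := eqVneq (m + 4)%N k.
  rewrite (_ : succ_index k == m = false)%N; last first.
    by rewrite /succ_index; case: ifP; lia.
  by rewrite mulr0 mulr1 mulr0 add0r addr0 -mk4 PoszD addrK extend_nat.
have [mn|mn] := eqVneq (succ_index k) m.
  by rewrite mn !mulr0 mulr1 !add0r.
rewrite !mulr0 !addr0.
have [cl|] := eqVneq (k %% 4)%N (fourier_index N m %% 4)%N; last first.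
  exact: (opL_class hN hT).
have [up|lo] := ltnP (k + 4) (fourier_index N m).
  exact: (opL_upper hN hT).
have mN1 : (m < N.-1)%N.
  move: rk mn cl lo; rewrite /admissible /succ_index /fourier_index.
  by do 2!case: ifP; lia.
have om : fourier_index N m = m by rewrite /fourier_index mN1.
have ok : fourier_index N k = k by rewrite /fourier_index kN.
rewrite dot_opL // dotC // (opL_upper hN hT) //; first lia.
move: rk mn cl lo; rewrite ok om /admissible /succ_index.
by case: ifP; lia.
Qed.

Lemma coef_b_neq0 k : admissible N k -> coef_b k%:Z != 0.
Proof.
move=> rk; have kN : (k < N.-1)%N by move: rk; rewrite /admissible; lia.
apply/eqP => b0; apply: (opL_raises hN hT rk) => m /andP[km mN].
rewrite opL_three_terms // b0 scale0r addr0 !(dotDl hN) !(dotZl hN).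
rewrite dot_extend_prev ?(hermite_orth hT) //; try lia.
have [-> ->] : (k == m = false) /\ (m + 4 == k = false)%N by lia.
by rewrite !mulr0 addr0.
Qed.

End Recurrence.

Theorem theorem1p6 (R : realType) (N : nat) (hN : (2 <= N)%N)
    (T : N.-tuple (pervec N R)) (hT : minimal_hermite_basis T) :
  let T_ := extend T in
  exists a b : int -> R,
    (forall n : int, n < 0 -> b n = 0) /\
    (forall n : int, 0 <= n ->
       [\/ n < N%:Z - 5,
           odd N /\ n = N%:Z - 5
         | ~~ odd N /\ n = N%:Z - 4] ->
       [/\ b n != 0,
           T_ (n + 4) = (b n)^-1 *:
             (opL (T_ n) - a n *: T_ n - b (n - 4) *: T_ (n - 4)),
           a n = dot (opL (T_ n)) (T_ n),
           b n ^+ 2 =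
             norm (opL (T_ n) - a n *: T_ n - b (n - 4) *: T_ (n - 4)) ^+ 2
         & norm (opL (T_ n) - a n *: T_ n - b (n - 4) *: T_ (n - 4)) ^+ 2 =
             norm (opL (T_ n)) ^+ 2 - a n ^+ 2 - b (n - 4) ^+ 2]).
Proof.
exists (coef_a T), (coef_b T); split=> [n n0|[k _|//]].
  by rewrite /coef_b n0.
move=> kN; have rk : admissible N k.
  by rewrite /admissible; case: kN => [|[]|[]]; lia.
have kN' : (k < N)%N by move: rk; rewrite /admissible; lia.
have succN : (succ_index N k < N)%N by rewrite /succ_index; case: ifP; lia.
have b0 := coef_b_neq0 hN hT rk; have LT := opL_three_terms hN hT rk.
have aE : coef_a T k%:Z = dot (opL T`_k) T`_k by rewrite /coef_a extend_nat.
have bE := coef_b_succ hN T rk; have b'E := coef_b_prev hN T rk.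
rewrite extend_succ // extend_nat //.
have -> : opL T`_k - coef_a T k *: T`_k -
    coef_b T (k%:Z - 4) *: extend T (k%:Z - 4) =
  coef_b T k *: T`_(succ_index N k).
  by rewrite {1}LT -[LHS]addrA -opprD addrAC subrr add0r.
rewrite !sqr_norm // (dotZl hN) (dotZr hN) (hermite_orth hT) // eqxx mulr1.
split=> //; first by rewrite scalerA mulVf // scale1r.
rewrite -!expr2 {2}LT !(dotDr hN) !(dotZr hN) -aE -bE -b'E.
by ring.
Qed.
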